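(* Let $n$ be a positive integer, and let $F$ be a field with $p(F)\geqslant (n-1)^2$. Let $a_1,\ldots,a_n\in F^*$, and suppose that $A_1,\ldots,A_n$ are finite subsets of $F$ with $|A_i|\geqslant 2n-2$ for $i=1,\ldots,n$. Then, for the set $$C=\{a_1x_1+\cdots+a_nx_n:\ x_1\in A_1,\ldots,x_n\in A_n,\ \text{and}\ x_i\neq x_j\ \text{if}\ i\neq j\},$$ we have $$|C|\geqslant\min\{p(F)-\delta,\ |A_1|+\cdots+|A_n|-n^2+1\},$$ where $\delta=1$ if $n=2$ and $a_1+a_2=0$, and $\delta=0$ otherwise.
   Context: $F^*=F\setminus\{0\}$. $p(F)$ denotes the additive order of the multiplicative identity of $F$: it equals the characteristic of $F$ if this is a prime, and $p(F)=+\infty$ if $F$ has characteristic zero (in which case $\min\{p(F)-c,\,x\}=x$ for integers $c,x$). *)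

(* Defs.v *)
From HB Require Import structures.
From mathcomp Require Import all_boot all_order all_algebra finmap.
From mathcomp Require Import boolp constructive_ereal.

Set Implicit Arguments.
Unset Strict Implicit.
Unset Printing Implicit Defensive.

Import Order.TTheory GRing.Theory Num.Theory.

Local Open Scope fset_scope.
Local Open Scope ring_scope.

(* Additive order of the multiplicative identity of F. Infinite order is +oo,
   so the value lives in the extended integers. *)
Definition one_order (F : fieldType) : \bar int :=
  match pselect (exists k : nat, (0 < k)%N && (k%:R == 0 :> F)) with
  | left h => (ex_minn h)%:Z%:E
  | right _ => +oo%E
  end.

Lemma one_order_pchar (F : fieldType) (p : nat) :
  p \in [pchar F] -> one_order F = p%:Z%:E.
Proof.
move=> pF; have p_pr := pcharf_prime pF.
rewrite /one_order; case: pselect => [h|[]]; last first.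
  by exists p; rewrite prime_gt0 //= pcharf0.
case: ex_minnP => k /andP[k0 /eqP kF] kmin; congr (_%:Z%:E).
apply/eqP; rewrite eqn_leq kmin ?prime_gt0 ?pcharf0 ?eqxx//=.
by apply: dvdn_leq => //; rewrite (dvdn_pcharf pF) kF.
Qed.

Lemma one_order_pchar0 (F : fieldType) :
  [pchar F] =i pred0 -> one_order F = +oo%E.
Proof.
move=> F0; rewrite /one_order; case: pselect => // kP; exfalso.
by case: kP => k; rewrite ((pcharf0P F).1 F0) lt0n; case: (k == 0%N).
Qed.

(* The tuples (x_1, ..., x_n) of A_1 x ... x A_n are the dependent finite
   functions x with x i in the finite type associated with A i. *)
Definition distinct_sums (F : fieldType) (n : nat) (a : 'I_n -> F)
    (A : 'I_n -> {fset F}) : {fset F} :=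
  (fun x : {dffun forall i : 'I_n, A i} => \sum_(i < n) a i * val (x i)) @`
    [set x : {dffun forall i : 'I_n, A i} | injectiveb (fun i => val (x i))].

Lemma distinct_sumsP (F : fieldType) (n : nat) (a : 'I_n -> F)
    (A : 'I_n -> {fset F}) (c : F) :
  c \in distinct_sums a A <->
  exists x : 'I_n -> F, [/\ forall i, x i \in A i,
    forall i j, i <> j -> x i <> x j & c = \sum_(i < n) a i * x i].
Proof.
split.
  case/imfsetP => x /=; rewrite inE => /injectiveP xI ->.
  exists (fun i => val (x i)); split=> [i|i j ij xij|//]; first exact: valP.
  by apply: ij; exact: xI.
case=> x [xA xI ->]; apply/imfsetP => /=.
pose y : {dffun forall i : 'I_n, A i} := finfun (fun i => [` xA i]).
have yE i : val (y i) = x i by rewrite ffunE.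
exists y; last by apply: eq_bigr => i _; rewrite yE.
rewrite inE; apply/injectiveP => i j; rewrite !yE => xij.
by case: (eqVneq i j) => // /eqP /xI.
Qed.

(* For n = 2 the sum of all the a_i is a_1 + a_2. *)
Definition defect (F : fieldType) (n : nat) (a : 'I_n -> F) : nat :=
  if (n == 2)%N && (\sum_(i < n) a i == 0) then 1%N else 0%N.

(* Main.v *)
Require Import Defs.
From HB Require Import structures.
From mathcomp Require Import all_boot all_order all_algebra finmap.
From mathcomp Require Import boolp constructive_ereal.
From mathcomp Require Import perm ring zify.

Set Implicit Arguments.
Unset Strict Implicit.
Unset Printing Implicit Defensive.

Import Order.TTheory GRing.Theory Num.Theory.

Local Open Scope fset_scope.
Local Open Scope ring_scope.

(** Put d = n(n-1)/2, let V be the Vandermonde product of the variables and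
L the linear form a_1 x_1 + ... + a_n x_n.  If the restricted sums took at most
m values, some monic G of degree m would vanish at all of them, and V * G(L)
would vanish on the whole box A_1 x ... x A_n.  By the Combinatorial
Nullstellensatz all its coefficients at monomials x^e of top degree m + d with
e_i < #|A_i| would then be 0.  Those are the coefficients of V * L^m, and
expanding V along permutations gives, when m and the e_i are smaller than the
characteristic,
  m! * (a_1^e_1 / e_1!) * ... * (a_n^e_n / e_n!) * D(e),
where D(e) is the determinant with entries b_i^j * e_i (e_i - 1) ... (e_i - j + 1)
and b_i = 1 / a_i (distinct_sums_gt).

It remains to find, for h_i <= #|A_i| - 1 with h_1 + ... + h_n = m + 2 d and all
h_i >= 2 n - 3, exponents e_i <= h_i with sum m + d and D(e) <> 0.  The lower
bound on p(F) is what makes it possible to shrink the h_i to the prescribed sum.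
The exponents are found two at a time (reachable_pair).  Suppose that e_1, ...,
e_{n-2} make the determinant of order n - 2 nonzero and that b_{n-1} + b_n <> 0.
When e_{n-1} + e_n is fixed, D is a polynomial in e_{n-1} of degree exactly
2 n - 3, so it does not vanish at all of the 2 n - 2 available values.  Among any
three nonzero b's two are not opposite, as 2 <> 0, so the pairs can be split off
by induction, except that two opposite entries may remain at the end.  For n = 2
the determinant is then a multiple of e_1 + e_2 = m + 1, whence the defect.  For
n = 4 they can be avoided unless one b is opposite to the three others, and then
again some choice of the last pair works unless h_1 + h_j = 1 in F for
j = 2, 3, 4; in that case one explicit choice of exponents has
D(e) = 24 b^6 (h_2 - 1) (reachable_seq4_star). *)

(** * Small integers in a field *)

(** The condition q < p(F), phrased uniformly in all characteristics. *)
Definition natr_neq0_upto (F : fieldType) (q : nat) : Prop :=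
  forall k, (0 < k <= q)%N -> k%:R != 0 :> F.

Lemma natr_neq0_uptoW (F : fieldType) (q r : nat) :
  (r <= q)%N -> natr_neq0_upto F q -> natr_neq0_upto F r.
Proof.
by move=> rq hq k /andP[k0 kr]; apply: hq; rewrite k0 (leq_trans kr rq).
Qed.

Lemma natr_fact_neq0 (F : fieldType) (q : nat) :
  natr_neq0_upto F q -> q`!%:R != 0 :> F.
Proof.
elim: q => [_|q IHq hq]; first by rewrite oner_eq0.
rewrite factS natrM mulf_neq0 //; first by apply: hq; rewrite /= leqnn.
by apply: IHq; exact: natr_neq0_uptoW hq.
Qed.

Lemma natr_inj_upto (F : fieldType) (q i j : nat) :
  natr_neq0_upto F q -> (i <= j + q)%N -> (j <= i + q)%N ->
  i%:R = j%:R :> F -> i = j.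
Proof.
move=> hq; wlog lij : i j / (i <= j)%N.
  move=> H lij lji eij; case: (leqP i j) => [/H|/ltnW/H]; first exact.
  by move=> Hji; apply/esym/Hji.
move=> _ lji eij; apply/eqP; rewrite eqn_leq lij leqNgt; apply/negP => ltij.
have /negP[] : (j - i)%:R != 0 :> F by apply: hq; rewrite subn_gt0 ltij leq_subLR.
by rewrite natrB // eij subrr.
Qed.

Lemma natr_ffact (R : comPzRingType) (n m : nat) :
  (n ^_ m)%:R = \prod_(i < m) (n%:R - i%:R) :> R.
Proof.
elim: m => [|m IHm]; first by rewrite big_ord0.
rewrite ffactnSr natrM IHm big_ord_recr /=.
case: (leqP m n) => [mn|nm]; first by rewrite natrB.
suff -> : \prod_(i < m) (n%:R - i%:R) = 0 :> R by rewrite !mul0r.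
by rewrite (bigD1 (Ordinal nm)) //= subrr mul0r.
Qed.

(** * Extracting a coefficient from values on a box *)

(** Univariate coefficient extraction: at e + 1 distinct nodes the Vandermonde
matrix is invertible, so some combination of values is the coefficient of X^e
on polynomials of degree at most e. *)
Lemma lagrange_weights (F : fieldType) (A : {fset F}) (e : nat) :
  (e < #|` A|)%N ->
  exists wx : (nat -> F) * (nat -> F),
    (forall k, (k <= e)%N -> wx.2 k \in A) /\
    forall u, (u <= e)%N ->
      \sum_(k < e.+1) wx.1 k * wx.2 k ^+ u = (u == e)%:R.
Proof.
move=> eA; pose x k := nth 0 (enum_fset A) k.
have lt_x k : (k <= e)%N -> (k < size (enum_fset A))%N.
  by move=> ke; exact: leq_ltn_trans ke eA.
pose V := Vandermonde e.+1 (\row_(k < e.+1) x k).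
have unitV : V \in unitmx.
  rewrite unitmxE det_Vandermonde unitfE; apply/prodf_neq0 => i _.
  apply/prodf_neq0 => j ij; rewrite !mxE subr_eq0.
  by rewrite nth_uniq ?(lt_x _ (leq_ord _)) ?fset_uniq // gtn_eqF.
pose W := invmx V *m (\col_(i < e.+1) (i == e :> nat)%:R).
exists (fun k => W (inord k) 0, x); split => [k ke|u ue] /=.
  by rewrite mem_nth ?lt_x.
have : (V *m W) (inord u) 0 = (u == e)%:R by rewrite mulKVmx // mxE inordK.
rewrite mxE => <-; apply: eq_bigr => k _.
by rewrite !mxE inord_val inordK // mulrC.
Qed.

(** The Combinatorial Nullstellensatz as a linear functional: a weighted sum of
values on the box that reads off the coefficient of x^e from any polynomial of
total degree at most that of x^e.  It is the tensor product of the univariate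
functionals; a monomial other than x^e of no larger degree has some exponent
below e_i, and the i-th factor kills it. *)
Lemma coefficient_functional (F : fieldType) (n : nat) (A : 'I_n -> {fset F})
    (e : 'I_n -> nat) :
  (forall i, e i < #|` A i|)%N ->
  exists (K : finType) (P : pred K) (w : K -> F) (x : K -> 'I_n -> F),
    (forall k i, P k -> x k i \in A i) /\
    forall u : 'I_n -> nat, (\sum_i u i <= \sum_i e i)%N ->
      \sum_(k | P k) w k * \prod_i x k i ^+ u i = [forall i, u i == e i]%:R.
Proof.
move=> eA; pose N := (\max_i e i).+1.
have eN i : (e i < N)%N by rewrite ltnS; exact: leq_bigmax.
have [wx wxP] := choice (fun i => lagrange_weights (eA i)).
pose K : finType := {ffun 'I_n -> 'I_N}.
exists K, (mem (family (fun i => [pred j : 'I_N | j < (e i).+1]%N))).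
exists (fun k : K => \prod_i (wx i).1 (k i)), (fun (k : K) i => (wx i).2 (k i)).
split=> [k i /familyP/(_ i)|u ue]; first by rewrite inE ltnS => /(proj1 (wxP i)).
under eq_bigr do rewrite -big_split /=.
rewrite -(bigA_distr_big_dep (fun i (j : 'I_N) => (j < (e i).+1)%N)
  (fun i j => (wx i).1 j * (wx i).2 j ^+ u i)) /=.
have sumE i : \sum_(j < N | (j < (e i).+1)%N) (wx i).1 j * (wx i).2 j ^+ u i =
    \sum_(j < (e i).+1) (wx i).1 j * (wx i).2 j ^+ u i.
  by rewrite (big_ord_widen _ (fun j => (wx i).1 j * (wx i).2 j ^+ u i) (eN i)).
under eq_bigr do rewrite sumE.
case: (boolP [exists i, u i < e i]%N) => [/existsP[i ui]|].
  rewrite (bigD1 i) //= (wxP i).2 1?ltnW // ltn_eqF // mul0r.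
  by case: forallP => // /(_ i); rewrite ltn_eqF.
rewrite negb_exists => /forallP eu.
have /forallP uE : [forall i, u i == e i].
  apply/forallP => i; rewrite eqn_leq andbC leqNgt eu /= leqNgt.
  apply/negP => ltei; move: ue; rewrite leqNgt => /negP[].
  rewrite (bigD1 i) //= [X in (_ < X)%N](bigD1 i) //= -addSn leq_add //.
  by apply: leq_sum => j _; rewrite leqNgt eu.
have -> : [forall i, u i == e i] by apply/forallP.
by apply: big1 => i _; rewrite (wxP i).2 (eqP (uE i)) ?eqxx.
Qed.

(** * The coefficient of a monomial in the Vandermonde times a power *)

(** The contribution of one variable to a multinomial coefficient: the
coefficient of x^(e - u) in exp (a x), and 0 when e < u. *)
Definition divided_power (F : fieldType) (a : F) (e u : nat) : F :=
  if (u <= e)%N then a ^+ (e - u) / (e - u)`!%:R else 0.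

Lemma divided_powerS (F : fieldType) (a : F) (e u : nat) :
  natr_neq0_upto F e ->
  a * divided_power a e u.+1 = (e - u)%:R * divided_power a e u.
Proof.
move=> he; rewrite /divided_power; case: (ltngtP u e) => [ue|_|->].
- have fe : (e - u.+1)`!%:R != 0 :> F.
    by apply: natr_fact_neq0; apply: natr_neq0_uptoW he; rewrite leq_subr.
  have neu : (e - u)%:R != 0 :> F by apply: he; rewrite subn_gt0 ue leq_subr.
  move: neu; rewrite -(subnSK ue) exprS factS natrM.
  by move: (_.+1%:R) => q q0; field; rewrite fe q0.
- by rewrite !mulr0.
- by rewrite subnn mul0r mulr0.
Qed.

(** Dividing by the quantity that does not depend on j leaves a falling
factorial, which is polynomial in e. *)
Lemma divided_power_ffact (F : fieldType) (a : F) (e j : nat) :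
  a != 0 -> natr_neq0_upto F e ->
  divided_power a e j = a ^+ e / e`!%:R * (a^-1 ^+ j * (e ^_ j)%:R).
Proof.
move=> a0 he; rewrite /divided_power; case: leqP => [je|ej]; last first.
  by rewrite ffact_small // !mulr0.
have fe : (e - j)`!%:R != 0 :> F.
  by apply: natr_fact_neq0; apply: natr_neq0_uptoW he; rewrite leq_subr.
have := natr_fact_neq0 he; rewrite -(ffact_fact je) natrM mulf_eq0 => /norP[fj _].
have -> : a ^+ e = a ^+ (e - j) * a ^+ j by rewrite -exprD subnK.
rewrite exprVn; field.
by rewrite fe fj expf_neq0.
Qed.

(** The functional that reads off x^e, applied to x^u L^t, gives the multinomial
coefficient of x^(e - u) in L^t.  Expanding one factor L turns x^u into the sum
of the a_i x_i x^u, so the values satisfy the Pascal-type recursion that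
divided_powerS provides for the right-hand side. *)
Lemma moment_monomial_form (F : fieldType) (n : nat) (a : 'I_n -> F)
    (e : 'I_n -> nat) (K : finType) (P : pred K) (w : K -> F)
    (x : K -> 'I_n -> F) :
  (forall i, natr_neq0_upto F (e i)) ->
  (forall u : 'I_n -> nat, (\sum_i u i <= \sum_i e i)%N ->
    \sum_(k | P k) w k * \prod_i x k i ^+ u i = [forall i, u i == e i]%:R) ->
  forall t (u : 'I_n -> nat), (\sum_i u i + t <= \sum_i e i)%N ->
    \sum_(k | P k) w k * (\prod_i x k i ^+ u i * (\sum_i a i * x k i) ^+ t) =
    if (\sum_i u i + t == \sum_i e i)%N
    then t`!%:R * \prod_i divided_power (a i) (e i) (u i) else 0.
Proof.
move=> he hx; elim=> [|t IHt] u ut.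
  rewrite addn0 in ut *; under [LHS]eq_bigr do rewrite expr0 mulr1.
  rewrite hx // mul1r; case: eqP => [ue|nue]; last first.
    case: forallP => // ue; case: nue; apply: eq_bigr => i _; exact/eqP.
  case: (boolP [forall i, u i == e i]) => [/forallP uE|].
    rewrite big1 // => i _; rewrite (eqP (uE i)) /divided_power leqnn subnn.
    by rewrite expr0 fact0 divr1.
  rewrite negb_forall => /existsP[i0 ui0].
  (* u and e have the same sum and differ, so some u_i exceeds e_i. *)
  suff [i ltei] : exists i, (e i < u i)%N.
    by rewrite (bigD1 i) //= /divided_power leqNgt ltei /= mul0r.
  apply/existsP; apply: contraTT (eqxx (\sum_i u i)%N); rewrite negb_exists.
  move=> /forallP leu; rewrite {2}ue ltn_eqF //.
  rewrite (bigD1 i0) //= [X in (_ < X)%N](bigD1 i0) //= -addSn leq_add //.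
    by rewrite ltn_neqAle ui0 leqNgt leu.
  by apply: leq_sum => j _; rewrite leqNgt leu.
(* v i is the exponent vector of x_i x^u. *)
pose v i j := (u j + (j == i))%N.
have sum_v i : (\sum_j v i j + t = \sum_j u j + t.+1)%N.
  rewrite big_split /= addnS -addSn -addn1; congr (_ + _ + _)%N.
  by rewrite (bigD1 i) //= eqxx big1 // => j /negPf->.
have prod_v k i : \prod_j x k j ^+ v i j = (\prod_j x k j ^+ u j) * x k i.
  under eq_bigr do rewrite exprD; rewrite big_split /=; congr (_ * _).
  by rewrite (bigD1 i) //= eqxx big1 ?mulr1 // => j /negPf->.
transitivity (\sum_i a i * \sum_(k | P k) w k *
    (\prod_j x k j ^+ v i j * (\sum_j a j * x k j) ^+ t)).
  under [RHS]eq_bigr do rewrite mulr_sumr; rewrite exchange_big /=.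
  apply: eq_bigr => k _; rewrite exprS mulr_suml !mulr_sumr.
  by apply: eq_bigr => i _; rewrite prod_v; ring.
under [LHS]eq_bigr => i _ do rewrite (IHt (v i)) ?sum_v //.
case: eqP => [ue|_]; last by apply: big1 => i _; rewrite mulr0.
have dpS i : a i * \prod_j divided_power (a j) (e j) (v i j) =
    (e i - u i)%:R * \prod_j divided_power (a j) (e j) (u j).
  rewrite (bigD1 i) //= [in RHS](bigD1 i) //= !mulrA /v eqxx addn1.
  rewrite divided_powerS //; congr (_ * _).
  by apply: eq_bigr => j /negPf->; rewrite addn0.
under eq_bigr => i _ do rewrite mulrCA dpS.
rewrite -mulr_sumr -mulr_suml factS natrM -natr_sum.
case: (boolP [exists i, e i < u i]%N) => [/existsP[i ltei]|].
  suff -> : \prod_j divided_power (a j) (e j) (u j) = 0 by rewrite !mulr0.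
  by rewrite (bigD1 i) //= /divided_power leqNgt ltei mul0r.
rewrite negb_exists => /forallP leu.
suff -> : (\sum_i (e i - u i) = t.+1)%N by ring.
apply/eqP; rewrite -(eqn_add2l (\sum_i u i)%N) ue -big_split /=.
by apply/eqP/eq_bigr => i _; rewrite subnKC // leqNgt leu.
Qed.

Definition ffact_mx (F : fieldType) (n : nat) (b : 'I_n -> F) (e : 'I_n -> nat) :
  'M[F]_n := \matrix_(i, j) (b i ^+ j * (e i ^_ j)%:R).

(** The polynomial method: V * G(L), with G monic of degree m vanishing on all
the sums, is zero on the box, whereas its coefficient at x^e is a nonzero
multiple of the determinant. *)
Lemma distinct_sums_gt (F : fieldType) (n m : nat) (a : 'I_n -> F)
    (A : 'I_n -> {fset F}) (e : 'I_n -> nat) :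
  (forall i, a i != 0) -> natr_neq0_upto F m ->
  (forall i, natr_neq0_upto F (e i)) ->
  (forall i, e i < #|` A i|)%N -> (\sum_i e i = m + 'C(n, 2))%N ->
  \det (ffact_mx (fun i => (a i)^-1) e) != 0 ->
  (m < #|` distinct_sums a A|)%N.
Proof.
move=> a0 hm he eA sum_e det0; rewrite ltnNge; apply/negP => leCm.
pose C := enum_fset (distinct_sums a A).
have [K [P [w [x [xA hx]]]]] := coefficient_functional eA.
pose L k := \sum_i a i * x k i.
(* The power of X pads the degree of G up to m. *)
pose G : {poly F} := 'X^(m - size C) * \prod_(c <- C) ('X - c%:P).
have sizeG : size G = m.+1.
  rewrite /G mulrC size_mulXn -?size_poly_gt0 ?size_prod_XsubC //.
  by rewrite addnS subnK.
have monicG : G`_m = 1.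
  suff /monicP : G \is monic by rewrite lead_coefE sizeG.
  by rewrite rpredM ?monicXn ?monic_prod_XsubC.
pose V k := \det (\matrix_(i, j < n) x k i ^+ j).
have vanish k : P k -> V k * G.[L k] = 0.
  move=> Pk; case: (boolP (injectiveb (x k))) => [/injectiveP xI|]; last first.
    case/injectivePn => i [j ij xij].
    rewrite [V k](determinant_alternate ij) ?mul0r //.
    by move=> l; rewrite !mxE xij.
  suff /rootP GL : root G (L k) by rewrite GL mulr0.
  rewrite rootM root_prod_XsubC; apply/orP; right.
  apply/distinct_sumsP; exists (x k); split=> // [i|i j ij /xI //].
  exact: xA.
suff : \sum_(k | P k) w k * (V k * G.[L k]) != 0.
  by rewrite big1 ?eqxx // => k Pk; rewrite vanish // mulr0.
have sum_perm (s : 'S_n) : (\sum_i (s i : nat) = 'C(n, 2))%N.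
  by rewrite -bin2_sum big_mkord [in RHS](reindex_inj (@perm_inj _ s)).
have expand k : w k * (V k * G.[L k]) = \sum_(s : 'S_n) \sum_(t < m.+1)
    (-1) ^+ s * G`_t * (w k * (\prod_i x k i ^+ s i * L k ^+ t)).
  have -> : V k = \sum_(s : 'S_n) (-1) ^+ s * \prod_i x k i ^+ s i.
    by apply: eq_bigr => s _; congr (_ * _); apply: eq_bigr => i _; rewrite mxE.
  rewrite horner_coef sizeG big_distrlr /= mulr_sumr.
  apply: eq_bigr => s _; rewrite mulr_sumr; apply: eq_bigr => t _.
  by move: ((-1) ^+ _) (\prod_i _) (L k ^+ t) => y z v; ring.
under eq_bigr do rewrite expand; rewrite exchange_big /=.
have moment (s : 'S_n) (t : nat) :=
  @moment_monomial_form F n a e K P w x he hx t (fun i => s i : nat).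
have -> : \sum_(s : 'S_n) \sum_(k | P k) \sum_(t < m.+1)
    (-1) ^+ s * G`_t * (w k * (\prod_i x k i ^+ s i * L k ^+ t)) =
  m`!%:R * (\prod_i (a i ^+ e i / (e i)`!%:R) *
    \det (ffact_mx (fun i => (a i)^-1) e)).
  rewrite /determinant !mulr_sumr; apply: eq_bigr => s _.
  rewrite exchange_big big_ord_recr /= [X in X + _]big1 => [|t _]; last first.
    rewrite -mulr_sumr moment sum_perm sum_e addnC ?leq_add2r ?eqn_add2r
      1?ltnW //.
    by rewrite ltn_eqF // mulr0.
  rewrite add0r -mulr_sumr moment sum_perm sum_e addnC ?eqxx // monicG mulr1.
  rewrite mulrCA [X in _ = _ * X]mulrCA -big_split /=; congr (_ * (_ * _)).
  by apply: eq_bigr => i _; rewrite mxE divided_power_ffact.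
rewrite !mulf_neq0 ?natr_fact_neq0 //; apply/prodf_neq0 => i _.
by rewrite mulf_neq0 ?expf_neq0 ?invr_eq0 ?natr_fact_neq0.
Qed.

(** * Top coefficients of determinants of polynomials *)

Lemma coef_mul_bound (R : nzRingType) (p q : {poly R}) (m n : nat) :
  (size p <= m.+1)%N -> (size q <= n.+1)%N ->
  (size (p * q)%R <= (m + n).+1)%N /\ (p * q)`_(m + n) = p`_m * q`_n.
Proof.
move=> hp hq; split.
  apply: leq_trans (size_polyMleq _ _) _.
  by move: (size p) (size q) hp hq => x y; lia.
have lt_m : (m < (m + n).+1)%N by rewrite ltnS leq_addr.
rewrite coefM (bigD1 (Ordinal lt_m)) //= addKn big1 ?addr0 // => j nej.
have {nej} : (j != m :> nat)%N by [].
case: ltngtP => // [jm|mj] _; last first.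
  by rewrite (nth_default 0 (leq_trans hp mj)) mul0r.
rewrite [q`__]nth_default ?mulr0 //; apply: leq_trans hq _.
by rewrite ltn_subRL ltn_add2r.
Qed.

Lemma coef_prod_bound (R : comNzRingType) (I : Type) (r : seq I)
    (p : I -> {poly R}) (d : I -> nat) :
  (forall i, size (p i) <= (d i).+1)%N ->
  (size (\prod_(i <- r) p i)%R <= (\sum_(i <- r) d i).+1)%N /\
  (\prod_(i <- r) p i)`_(\sum_(i <- r) d i) = \prod_(i <- r) (p i)`_(d i).
Proof.
move=> hp; elim: r => [|i r [IHs IHc]].
  by rewrite !big_nil size_poly1 coef1.
rewrite !big_cons; have [hs ->] := coef_mul_bound (hp i) IHs.
by rewrite IHc.
Qed.

(** If the degree of each entry is at most a row weight plus a column weight,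
every product in the Leibniz formula has the same degree bound, so the top
coefficient of the determinant is the determinant of the top coefficients. *)
Lemma coef_det_bound (R : comNzRingType) (n : nat) (M : 'M[{poly R}]_n)
    (r c : 'I_n -> nat) :
  (forall i j, size (M i j) <= (r i + c j).+1)%N ->
  (size (\det M) <= (\sum_i r i + \sum_j c j).+1)%N /\
  (\det M)`_(\sum_i r i + \sum_j c j) =
    \det (\matrix_(i, j) (M i j)`_(r i + c j)).
Proof.
move=> hM.
have sum_rc (s : 'S_n) : (\sum_i (r i + c (s i)) = \sum_i r i + \sum_j c j)%N.
  by rewrite big_split /= [X in (_ = _ + X)%N](reindex_inj (@perm_inj _ s)).
have hs (s : 'S_n) := @coef_prod_bound R _ (index_enum 'I_n)
  (fun i => M i (s i)) (fun i => r i + c (s i))%N (fun i => hM i (s i)).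
split.
  apply: leq_trans (size_sum _ _ _) _; apply/bigmax_leqP => s _.
  have [hsz _] := hs s; rewrite -(sum_rc s); apply: leq_trans hsz.
  by rewrite mulr_sign; case: (s : bool); rewrite ?size_polyN.
rewrite coef_sum; apply: eq_bigr => s _; have [_ hc] := hs s.
under [in RHS]eq_bigr do rewrite mxE.
by rewrite -hc sum_rc !mulr_sign; case: (s : bool); rewrite ?coefN.
Qed.

Lemma det_mx22 (R : comPzRingType) (M : 'M[R]_2) :
  \det M = M 0 0 * M 1 1 - M 0 1 * M 1 0.
Proof.
rewrite (expand_det_row _ 0) !big_ord_recl big_ord0 addr0 /cofactor !det_mx11.
rewrite !mxE /= expr0 mul1r expr1 mulN1r mulrN.
by do !congr (_ * _ - _ * _); congr (M _ _); apply: val_inj.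
Qed.

(** * Adding two indices to a nonvanishing determinant *)

(** The falling factorial of order j of c X + u. *)
Definition ffact_poly (F : fieldType) (c u : F) (j : nat) : {poly F} :=
  \prod_(l < j) (c *: 'X + (u - l%:R)%:P).

Lemma horner_ffact_poly (F : fieldType) (c u x : F) (e j : nat) :
  c * x + u = e%:R -> (ffact_poly c u j).[x] = (e ^_ j)%:R.
Proof.
move=> xe; rewrite horner_prod natr_ffact; apply: eq_bigr => l _.
by rewrite !hornerE -xe.
Qed.

Lemma coef_ffact_poly (F : fieldType) (c u : F) (j : nat) :
  (size (ffact_poly c u j) <= j.+1)%N /\ (ffact_poly c u j)`_j = c ^+ j.
Proof.
have := @coef_prod_bound F _ (index_enum 'I_j)
  (fun l : 'I_j => c *: 'X + (u - l%:R)%:P) (fun=> 1%N).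
rewrite sum1_card card_ord => -[l|hs hc].
  apply: leq_trans (size_polyD _ _) _; rewrite geq_max size_polyC.
  by rewrite (leq_trans (size_scale_leq _ _)) ?size_polyX // leqW // leq_b1.
split=> //; rewrite hc.
under eq_bigr do rewrite coefD coefZ coefX coefC /= mulr1 addr0.
by rewrite prodr_const card_ord.
Qed.

Local Notation node0 F := (0%R : F, 0%N, 0%N).

Definition ffact_det (F : fieldType) (n : nat) (t : seq (F * nat * nat)) : F :=
  \det (ffact_mx (fun i : 'I_n => (nth (node0 F) t i).1.1)
                 (fun i => (nth (node0 F) t i).2)).

(** An entry (b, h) of s stands for a coefficient b = 1 / a_i and a bound h on the
exponent e_i; t attaches to each entry the chosen exponent.  Lists are used
because the condition does not depend on the order of the entries
(reachable_perm), which makes it easy to choose which two entries to split off. *)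
Definition reachable (F : fieldType) (s : seq (F * nat)) : Prop :=
  exists t : seq (F * nat * nat),
    [/\ map fst t = s, all (fun z => z.2 <= z.1.2)%N t,
        (sumn (map snd t) + 'C(size s, 2) = sumn (map snd s))%N
      & ffact_det (size s) t != 0].

Lemma ffact_det_perm (F : fieldType) (n : nat) (t1 t2 : seq (F * nat * nat)) :
  size t2 = n -> perm_eq t1 t2 -> ffact_det n t2 != 0 -> ffact_det n t1 != 0.
Proof.
move=> st2; pose T2 : n.-tuple _ := tcast st2 (in_tuple t2).
have T2E : tval T2 = t2 by rewrite val_tcast.
rewrite -T2E => /tuple_permP[p ->].
suff -> : ffact_det n [tuple tnth T2 (p i) | i < n] = (-1) ^+ p * ffact_det n T2.
  by move=> d0; rewrite mulf_neq0 // signr_eq0.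
rewrite /ffact_det -det_perm -det_mulmx -row_permE; congr (\det _).
by apply/matrixP => i j; rewrite !mxE -!tnth_nth tnth_mktuple.
Qed.

Lemma reachable_perm (F : fieldType) (s1 s2 : seq (F * nat)) :
  perm_eq s2 s1 -> reachable s1 -> reachable s2.
Proof.
move=> s21 [t1 [t1s t1h t1e t1d]].
have [Is pIs s2E] := perm_iotaP (0, 0%N) s21.
have size_t1 : size t1 = size s1 by rewrite -t1s size_map.
pose t2 := map (nth (node0 F) t1) Is.
have t21 : perm_eq t2 t1.
  by apply/(perm_iotaP (node0 F)); exists Is; rewrite ?size_t1.
exists t2; split.
- rewrite s2E -map_comp; apply/eq_in_map => i; rewrite (perm_mem pIs) mem_iota /=.
  by move=> i_lt; rewrite -t1s (nth_map (node0 F)) // size_t1.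
- by rewrite (perm_all _ t21).
- rewrite (perm_size s21) (perm_sumn (perm_map snd t21)) t1e.
  exact/esym/perm_sumn/perm_map.
- by rewrite (perm_size s21); apply: ffact_det_perm t21 t1d.
Qed.

Lemma exists_non_root (F : fieldType) (p : {poly F}) (d x0 : nat) :
  (size p <= d.+1)%N -> p`_d != 0 -> natr_neq0_upto F d ->
  exists2 k, (k <= d)%N & p.[(x0 + k)%:R] != 0.
Proof.
move=> sp pd hd; pose rs := [seq (x0 + k)%:R : F | k <- iota 0 d.+1].
have p0 : p != 0 by apply: contraNneq pd => ->; rewrite coef0.
have : ~~ all (root p) rs.
  apply/negP => /(max_poly_roots p0); rewrite size_map size_iota => H.
  have /H : uniq rs; last by rewrite ltnNge sp.
  rewrite map_inj_in_uniq ?iota_uniq // => i j.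
  rewrite !mem_iota !add0n !ltnS => /andP[_ id] /andP[_ jd] /(natr_inj_upto hd).
  by move=> H'; apply/(@addnI x0)/H'; lia.
rewrite -has_predC => /hasP[_ /mapP[k + ->]] /= kx.
by rewrite mem_iota add0n ltnS /= => kd; exists k.
Qed.

(** The matrix of the determinant in which the last two exponents are X and
N - X; evaluation at an exponent recovers the numerical determinant. *)
Definition pair_poly_mx (F : fieldType) (k : nat) (t : seq (F * nat * nat))
    (b b' : F) (N : nat) : 'M[{poly F}]_(k + 2) :=
  \matrix_(i, j)
    if (i < k)%N then
      ((nth (node0 F) t i).1.1 ^+ j * ((nth (node0 F) t i).2 ^_ j)%:R)%:P
    else if (i == k :> nat)%N then b ^+ j *: ffact_poly 1 0 j
    else b' ^+ j *: ffact_poly (- 1) N%:R j.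

Lemma horner_pair_poly_mx (F : fieldType) (t : seq (F * nat * nat)) (b b' : F)
    (h h' e e' : nat) :
  (\det (pair_poly_mx (size t) t b b' (e + e'))).[e%:R] =
  ffact_det (size t + 2) (t ++ [:: (b, h, e); (b', h', e')]).
Proof.
rewrite -horner_evalE -det_map_mx; congr (\det _); apply/matrixP => i j.
rewrite !mxE /= /horner_eval nth_cat; case: ifP => [_|/negbT].
  by rewrite hornerC.
rewrite -leqNgt => le_i.
have : (i == (size t).+1 :> nat) || (i <= size t)%N.
  by have := ltn_ord i; lia.
case/orP => [/eqP i1|ik].
  rewrite i1 gtn_eqF // subSnn /= hornerZ (@horner_ffact_poly _ _ _ _ e') //.
  by rewrite natrD; ring.
have -> : i = size t :> nat by apply/eqP; rewrite eqn_leq le_i ik.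
by rewrite eqxx subnn /= hornerZ (@horner_ffact_poly _ _ _ _ e) // mul1r addr0.
Qed.

(** Weights for coef_det_bound: 0 for the first k rows and k for the last two;
0 for the first k + 1 columns and 1 for the last.  The matrix of top coefficients
is block triangular, with the determinant of order k in one corner and a 2 x 2
Vandermonde-like block in b and - b' in the other. *)
Lemma coef_det_pair_poly_mx (F : fieldType) (k : nat) (t : seq (F * nat * nat))
    (b b' : F) (N : nat) :
  let p := \det (pair_poly_mx k t b b' N) in
  (size p <= (2 * k + 1).+1)%N /\
  p`_(2 * k + 1) = ffact_det k t * (b ^+ k * (- b') ^+ k * - (b + b')).
Proof.
pose r (i : 'I_(k + 2)) := if (i < k)%N then 0%N else k.
pose c (j : 'I_(k + 2)) := (j - k)%N.
have ltk i : (k + i < k)%N = false by rewrite ltnNge leq_addr.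
have sum_rc : (\sum_i r i + \sum_j c j = 2 * k + 1)%N.
  rewrite !big_split_ord /= !big_ord_recl !big_ord0 /r /c /= !ltk.
  rewrite big1 ?big1 => [|i _|i _]; last by rewrite ltn_ord.
    by rewrite -[bump 0 0]/1%N; lia.
  by apply/eqP; rewrite subn_eq0 ltnW /=.
have hM i j : (size (pair_poly_mx k t b b' N i j) <= (r i + c j).+1)%N.
  rewrite mxE /r /c; case: ifP => _.
    by apply: leq_trans (size_polyC_leq1 _) _.
  have hj : (j.+1 <= (k + (j - k)).+1)%N by rewrite ltnS -leq_subLR.
  case: ifP => _; apply: leq_trans (size_scale_leq _ _) _;
    exact: leq_trans (proj1 (coef_ffact_poly _ _ _)) hj.
have := coef_det_bound hM; rewrite sum_rc => -[hs hc]; split=> //; rewrite hc.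
set M := \matrix_(i, j) _.
have drM : dlsubmx M = 0.
  apply/matrixP => i j; rewrite !mxE /= /r /c ltk.
  have /eqP -> : (j - k == 0)%N by rewrite subn_eq0 ltnW /=.
  rewrite addn0; case: ifP => _; rewrite coefZ [X in _ * X]nth_default ?mulr0 //;
    exact: leq_trans (proj1 (coef_ffact_poly _ _ _)) _.
rewrite -(submxK M) drM det_ublock det_mx22; congr (_ * _).
  congr (\det _); apply/matrixP => i j; rewrite !mxE /= /r /c ltn_ord.
  have /eqP -> : (j - k == 0)%N by rewrite subn_eq0 ltnW /=.
  by rewrite coefC.
have col0 : (k + (rshift k (0%R : 'I_2) - k) = k)%N.
  by rewrite /= addn0 subnn addn0.
have col1 : (k + (rshift k (1%R : 'I_2) - k) = k.+1)%N.
  by rewrite /= addn1 subSnn addn1.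
have row1 : (k + 1 %% 2 = k.+1)%N by rewrite addn1.
rewrite !mxE /= /r /c !ltk col0 col1 row1 !addn0 !eqxx gtn_eqF //.
rewrite !coefZ !(proj2 (coef_ffact_poly _ _ _)).
rewrite !expr1n !mulr1 (exprNn b') !exprS.
by move: (b ^+ k) (b' ^+ k) ((-1) ^+ k) => x y z; ring.
Qed.

(** The new exponents are h - d + k and h' - k with d = 2 * size s + 1 and
0 <= k <= d: their sum is fixed and falls short of h + h' by
d = 'C(size s + 2, 2) - 'C(size s, 2), and there is one more candidate than the
degree of the polynomial. *)
Lemma reachable_pair (F : fieldType) (s : seq (F * nat)) (b b' : F) (h h' : nat) :
  b != 0 -> b' != 0 -> b + b' != 0 ->
  (2 * size s + 1 <= h)%N -> (2 * size s + 1 <= h')%N ->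
  natr_neq0_upto F (2 * size s + 1) ->
  reachable s -> reachable (s ++ [:: (b, h); (b', h')]).
Proof.
move=> b0 b'0 bb'; set d := (2 * size s + 1)%N => dh dh' hd [t [ts th te td]].
have size_t : size t = size s by rewrite -ts size_map.
have := coef_det_pair_poly_mx (size s) t b b' (h + h' - d).
rewrite -/d => -[hs hc].
have [|k kd] := exists_non_root (h - d) hs _ hd.
  by rewrite hc !mulf_neq0 ?expf_neq0 ?oppr_eq0.
have NE : (h + h' - d = (h - d + k) + (h' - k))%N by lia.
rewrite NE -size_t (@horner_pair_poly_mx _ _ _ _ h h') => det0.
exists (t ++ [:: (b, h, h - d + k); (b', h', h' - k)])%N; split.
- by rewrite map_cat ts.
- by rewrite all_cat th /= andbT; lia.
- rewrite !map_cat !sumn_cat -te size_cat addn2 !binS !bin1 bin0 /= /d in NE *.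
  by move: ('C(_, _)) (sumn _) => x y; lia.
- by rewrite size_cat -size_t.
Qed.

(** * Short lists *)

Lemma reachable_nil (F : fieldType) : reachable ([::] : seq (F * nat)).
Proof. by exists [::]; rewrite /ffact_det det_mx00 oner_eq0. Qed.

Lemma reachable_seq1 (F : fieldType) (x : F * nat) : reachable [:: x].
Proof.
exists [:: (x, x.2)]; split; rewrite //= ?leqnn //.
  by rewrite bin_small // addn0.
by rewrite /ffact_det det_mx11 mxE /= mulr1 expr0 oner_eq0.
Qed.

(** For opposite coefficients the determinant of order 2 depends on the sum of the
exponents only, which is the source of the defect. *)
Lemma reachable_opp (F : fieldType) (b : F) (h h' : nat) :
  b != 0 -> (0 < h)%N -> (h + h' - 1)%:R != 0 :> F ->
  reachable [:: (b, h); (- b, h')].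
Proof.
move=> b0 h0 hh'; exists [:: (b, h, h - 1); (- b, h', h')]%N.
split; rewrite //= ?leqnn ?leq_subr //; first by rewrite bin2 /=; lia.
rewrite /ffact_det /= det_mx22 !mxE /=.
have -> : b ^+ 0 * ((h - 1) ^_ 0)%:R * ((- b) ^+ (1 %% 2) * (h' ^_ (1 %% 2))%:R) -
  b ^+ (1 %% 2) * ((h - 1) ^_ (1 %% 2))%:R * ((- b) ^+ 0 * (h' ^_ 0)%:R) =
  - (b * (h + h' - 1)%:R).
  rewrite !ffactn0 -[(1 %% 2)%N]/1%N !ffactn1 addnC -addnBA // natrD; ring.
by rewrite oppr_eq0 mulf_neq0.
Qed.

(** The indices are arbitrary ordinals with values 0, 1, 2, so that the lemma
applies whatever form the ordinals have after a cofactor expansion. *)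
Lemma det_mx33 (R : comPzRingType) (M : 'M[R]_3) (i j k : 'I_3) :
  i = 0%N :> nat -> j = 1%N :> nat -> k = 2%N :> nat ->
  \det M = M i i * (M j j * M k k - M j k * M k j)
          - M i j * (M j i * M k k - M j k * M k i)
          + M i k * (M j i * M k j - M j j * M k i).
Proof.
move=> i0 j1 k2.
have -> : i = ord0 by apply: val_inj.
have -> : j = lift ord0 ord0 by apply: val_inj.
have -> : k = lift ord0 (lift ord0 ord0) by apply: val_inj.
rewrite (expand_det_row _ ord0) !big_ord_recl big_ord0 /cofactor !det_mx22 !mxE.
have -> : lift (lift ord0 (lift ord0 ord0)) (1 : 'I_2) = lift ord0 ord0 :> 'I_3.
  by apply: val_inj.
have -> : lift (lift ord0 (lift ord0 ord0)) (0 : 'I_2) = ord0 :> 'I_3.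
  by apply: val_inj.
have -> : lift (lift ord0 ord0) (0 : 'I_2) = ord0 :> 'I_3.
  by apply: val_inj.
have -> : lift (lift ord0 ord0) (1 : 'I_2) = lift ord0 (lift ord0 ord0) :> 'I_3.
  by apply: val_inj.
have -> : lift ord0 (0 : 'I_2) = lift ord0 ord0 :> 'I_3.
  by apply: val_inj.
have -> : lift ord0 (1 : 'I_2) = lift ord0 (lift ord0 ord0) :> 'I_3.
  by apply: val_inj.
rewrite /= /bump /= expr0 expr1 expr2; ring.
Qed.

(** The exceptional configuration for n = 4: three coefficients opposite to the
first one, and exponents known only through their images in F. *)
Lemma ffact_det4 (F : fieldType) (B H : F) (h0 h1 h2 h3 : nat)
    (x0 x1 x2 x3 : F * nat) :
  h0%:R = 1 - H -> h1%:R = H - 1 -> h2%:R = H - 2 -> h3%:R = H - 3 ->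
  x0.1 = B -> x1.1 = - B -> x2.1 = - B -> x3.1 = - B ->
  ffact_det 4 [:: (x0, h0); (x1, h1); (x2, h2); (x3, h3)] =
    24 * B ^+ 6 * (H - 1).
Proof.
move=> e0 e1 e2 e3 f0 f1 f2 f3.
rewrite /ffact_det (expand_det_row _ ord0) !big_ord_recl big_ord0 /cofactor.
rewrite !(@det_mx33 _ _ ord0 (lift ord0 ord0) (lift ord0 (lift ord0 ord0))) //.
rewrite !mxE /= /bump /= !natr_ffact !big_ord_recl !big_ord0 /= /bump /=.
rewrite e0 e1 e2 e3 f0 f1 f2 f3.
ring.
Qed.
Definition large_pair (F : fieldType) (d : nat) (x : F * nat) : Prop :=
  [/\ x.1 != 0, (d <= x.2)%N & natr_neq0_upto F x.2].

Lemma reachable_seq2 (F : fieldType) (x y : F * nat) :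
  x.1 != 0 -> y.1 != 0 -> (0 < x.2)%N -> (0 < y.2)%N ->
  x.1 + y.1 != 0 \/ (x.2 + y.2 - 1)%:R != 0 :> F -> reachable [:: x; y].
Proof.
case: x y => [b h] [b' h'] /= b0 b'0 h0 h'0.
have [bb' [/eqP//|hh']|bb' _] := eqVneq (b + b') 0.
  by rewrite -(addr0_eq bb'); apply: reachable_opp.
apply: (@reachable_pair F [::]) => //; last exact: reachable_nil.
by case=> [|[|k]] //; rewrite oner_eq0.
Qed.

Lemma reachable_seq4_split (F : fieldType) (x y z w : F * nat) :
  large_pair 5 x -> large_pair 5 y -> large_pair 5 z -> large_pair 5 w ->
  z.1 + w.1 != 0 -> x.1 + y.1 != 0 \/ (x.2 + y.2 - 1)%:R != 0 :> F ->
  reachable [:: x; y; z; w].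
Proof.
move=> [x0 x5 _] [y0 y5 _] [z0 z5 hz] [w0 w5 _] zw xy.
move: z w z0 z5 hz w0 w5 zw => [b h] [b' h'] /= b0 h5 hh b'0 h'5 bb'.
apply: (@reachable_pair F [:: x; y]) => //; first exact: natr_neq0_uptoW hh.
by apply: reachable_seq2; rewrite ?(leq_trans _ x5) ?(leq_trans _ y5).
Qed.

(** Any two of x1, x2, x3 can be the pair added last, leaving x0 and the third,
which are opposite; this fails only if h_0 + h_j = 1 in F for j = 1, 2, 3, and
then the slack 6 = 0 + 1 + 2 + 3 can be distributed so that the three equal
coefficients get distinct exponents. *)
Lemma reachable_seq4_star (F : fieldType) (x0 x1 x2 x3 : F * nat) :
  large_pair 5 x0 -> large_pair 5 x1 -> large_pair 5 x2 -> large_pair 5 x3 ->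
  x1.1 = - x0.1 -> x2.1 = - x0.1 -> x3.1 = - x0.1 ->
  reachable [:: x0; x1; x2; x3].
Proof.
move=> l0 l1 l2 l3 e1 e2 e3.
have [b0 h0 hh0] := l0; have [_ h1 hh1] := l1; have [_ h2 _] := l2.
have [_ h3 _] := l3.
have neq0 k : (0 < k < 5)%N -> k%:R != 0 :> F.
  by move=> k5; apply: hh0; lia.
have opp2 : - x0.1 + - x0.1 != 0.
  by rewrite -opprD oppr_eq0 -mulr2n -mulr_natr mulf_neq0 // neq0.
have [t1|t1] := eqVneq ((x0.2 + x1.2 - 1)%:R : F) 0; last first.
  by apply: reachable_seq4_split => //; [rewrite e2 e3 | right].
have [t2|t2] := eqVneq ((x0.2 + x2.2 - 1)%:R : F) 0; last first.
  apply: (@reachable_perm _ [:: x0; x2; x1; x3]).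
    by apply/seq.permP => p /=; lia.
  by apply: reachable_seq4_split => //; [rewrite e1 e3 | right].
have [t3|t3] := eqVneq ((x0.2 + x3.2 - 1)%:R : F) 0; last first.
  apply: (@reachable_perm _ [:: x0; x3; x2; x1]).
    by apply/seq.permP => p /=; lia.
  by apply: reachable_seq4_split => //; [rewrite e2 e1 | right].
have tE h : (5 <= h)%N -> (x0.2 + h - 1)%:R = 0 :> F -> x0.2%:R = 1 - h%:R :> F.
  move=> h5; rewrite natrB; last by lia.
  rewrite natrD => E; apply/eqP; rewrite -subr_eq0 -[X in _ == X]E.
  by apply/eqP; ring.
pose H : F := x1.2%:R.
have E1 := tE _ h1 t1; have E2 := tE _ h2 t2; have E3 := tE _ h3 t3.
have H2 : x2.2%:R = H by apply: oppr_inj; apply: (@addrI _ 1); rewrite -E2 E1.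
have H3 : x3.2%:R = H by apply: oppr_inj; apply: (@addrI _ 1); rewrite -E3 E1.
exists [:: (x0, x0.2); (x1, x1.2 - 1); (x2, x2.2 - 2); (x3, x3.2 - 3)]%N.
split => //.
- by rewrite /= !leq_subr leqnn.
- by rewrite /= -[binomial _ _]/6%N; lia.
rewrite (@ffact_det4 _ x0.1 H) //; try by rewrite natrB ?H2 ?H3 //; lia.
rewrite !mulf_neq0 ?expf_neq0 //.
  by rewrite -[24%N]/(2 * 3 * 4)%N !natrM !mulf_neq0 ?neq0.
have -> : H - 1 = (x1.2 - 1)%:R by rewrite natrB //; lia.
by apply: hh1; lia.
Qed.

Lemma opposite_triangle (F : fieldType) (x y z : F) :
  2%:R != 0 :> F -> x != 0 -> x + y = 0 -> y + z = 0 -> x + z = 0 -> False.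
Proof.
move=> two x0 /addr0_eq <- /addr0_eq; rewrite opprK => <- /eqP.
by rewrite -mulr2n -mulr_natr mulf_eq0 (negPf two) (negPf x0).
Qed.

(** If none of the three perfect matchings of the four entries consists of pairs
that are not opposite, each contains an opposite pair.  Three such pairs, one
from each matching, form a triangle or a star, and a triangle would give
2 b = 0. *)
Lemma reachable_seq4 (F : fieldType) (x0 x1 x2 x3 : F * nat) :
  large_pair 5 x0 -> large_pair 5 x1 -> large_pair 5 x2 -> large_pair 5 x3 ->
  reachable [:: x0; x1; x2; x3].
Proof.
move=> l0 l1 l2 l3.
have two : 2%:R != 0 :> F by case: l0 => _ h0; apply; lia.
have [n0 n1 n2 n3] : [/\ x0.1 != 0, x1.1 != 0, x2.1 != 0 & x3.1 != 0].
  by case: l0 l1 l2 l3 => [? _ _] [? _ _] [? _ _] [? _ _].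
have matching y0 y1 y2 y3 : perm_eq [:: x0; x1; x2; x3] [:: y0; y1; y2; y3] ->
    large_pair 5 y0 -> large_pair 5 y1 -> large_pair 5 y2 -> large_pair 5 y3 ->
    [\/ reachable [:: x0; x1; x2; x3], y0.1 + y1.1 = 0 | y2.1 + y3.1 = 0].
  move=> py m0 m1 m2 m3; have [->|y01] := eqVneq (y0.1 + y1.1) 0.
    by constructor 2.
  have [->|y23] := eqVneq (y2.1 + y3.1) 0; first by constructor 3.
  constructor 1; apply: reachable_perm py _.
  by apply: reachable_seq4_split => //; left.
have star y0 y1 y2 y3 : perm_eq [:: x0; x1; x2; x3] [:: y0; y1; y2; y3] ->
    large_pair 5 y0 -> large_pair 5 y1 -> large_pair 5 y2 -> large_pair 5 y3 ->
    y0.1 + y1.1 = 0 -> y0.1 + y2.1 = 0 -> y0.1 + y3.1 = 0 ->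
    reachable [:: x0; x1; x2; x3].
  move=> py m0 m1 m2 m3 /addr0_eq e1 /addr0_eq e2 /addr0_eq e3.
  exact: reachable_perm py (reachable_seq4_star _ _ _ _ _ _ _).
have tri := @opposite_triangle F _ _ _ two.
have p1 : perm_eq [:: x0; x1; x2; x3] [:: x0; x2; x1; x3].
  by apply/seq.permP => p /=; lia.
have p2 : perm_eq [:: x0; x1; x2; x3] [:: x0; x3; x1; x2].
  by apply/seq.permP => p /=; lia.
have [//|o01|o23] := matching _ _ _ _ (perm_refl _) l0 l1 l2 l3;
have [//|o02|o13] := matching _ _ _ _ p1 l0 l2 l1 l3;
have [//|o03|o12] := matching _ _ _ _ p2 l0 l3 l1 l2.
- exact: (star x0 x1 x2 x3).
- by case: (tri _ _ _ n0 o01 o12 o02).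
- by case: (tri _ _ _ n0 o01 o13 o03).
- apply: (star x1 x0 x2 x3) => //; last by rewrite addrC.
  by apply/seq.permP => p /=; lia.
- by case: (tri _ _ _ n0 o02 o23 o03).
- apply: (star x2 x0 x1 x3) => //; try by rewrite addrC.
  by apply/seq.permP => p /=; lia.
- apply: (star x3 x0 x1 x2) => //; try by rewrite addrC.
  by apply/seq.permP => p /=; lia.
- by case: (tri _ _ _ n1 o12 o23 o13).
Qed.

Lemma large_pair_le (F : fieldType) (d d' : nat) (x : F * nat) :
  (d' <= d)%N -> large_pair d x -> large_pair d' x.
Proof. by move=> dd' [x0 /(leq_trans dd')]. Qed.

(** * Choosing the exponents *)

(** Split off two entries that are not opposite; among three entries there are
such two.  The excluded length 2 is reached only from length 4, which is treated
separately. *)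
Lemma reachable_large (F : fieldType) (s : seq (F * nat)) :
  size s != 2%N -> (forall x, x \in s -> large_pair (2 * size s - 3) x) ->
  reachable s.
Proof.
have [m] := ubnP (size s); elim: m s => // m IHm s; rewrite ltnS => sm s2 sL.
have step (x y : F * nat) (r : seq (F * nat)) :
    size s != 4%N -> perm_eq s (r ++ [:: x; y]) -> x.1 + y.1 != 0 -> reachable s.
  move=> s4 pr xy.
  have size_s : size s = (size r + 2)%N by rewrite (perm_size pr) size_cat.
  have [xs ys] : x \in s /\ y \in s.
    by rewrite !(perm_mem pr) !mem_cat !inE !eqxx !orbT.
  have dE : (2 * size s - 3 = 2 * size r + 1)%N by lia.
  have [x0 xd hx] := sL x xs; have [y0 yd _] := sL y ys.
  apply: (reachable_perm pr); rewrite dE in xd yd.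
  rewrite (surjective_pairing x) (surjective_pairing y).
  apply: reachable_pair => //; first exact: natr_neq0_uptoW hx.
  apply: IHm => [||z zr]; [lia|lia|].
  apply: (@large_pair_le _ (2 * size s - 3)); first by lia.
  by apply: sL; rewrite (perm_mem pr) mem_cat zr.
case: s sm s2 sL step => [|x [|y [|z t]]] //.
- by move=> _ _ _ _; exact: reachable_nil.
- by move=> _ _ _ _; exact: reachable_seq1.
move=> _ _ sL step.
(* Here the list has length 4. *)
have [t1|t1] := eqVneq (size t) 1%N.
  case: t t1 sL step => [|w [|]] // _ sL _.
  by apply: reachable_seq4; apply: sL; rewrite !inE eqxx ?orbT.
have s4 : size [:: x, y, z & t] != 4%N by [].
have [x0 xd hx] := sL x (mem_head _ _).
have two : 2%:R != 0 :> F by apply: hx; move: xd => /=; lia.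
have [xy|xy] := eqVneq (x.1 + y.1) 0; last first.
  apply: (step x y (z :: t)) => //.
  by apply/seq.permP => p; rewrite count_cat /=; lia.
have [yz|yz] := eqVneq (y.1 + z.1) 0; last first.
  apply: (step y z (x :: t)) => //.
  by apply/seq.permP => p; rewrite count_cat /=; lia.
apply: (step x z (y :: t)) => //.
  by apply/seq.permP => p; rewrite count_cat /=; lia.
by apply/eqP => xz; exact: (opposite_triangle two x0 xy yz xz).
Qed.

Lemma reachable_exponents (F : fieldType) (n : nat) (b : 'I_n -> F)
    (h : 'I_n -> nat) :
  reachable [seq (b i, h i) | i <- enum 'I_n] ->
  exists e : 'I_n -> nat, [/\ forall i, (e i <= h i)%N,
    (\sum_i e i + 'C(n, 2) = \sum_i h i)%N & \det (ffact_mx b e) != 0].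
Proof.
case=> t; rewrite size_map size_enum_ord => -[ts th te td].
have size_t : size t = n by rewrite -(size_map fst) ts size_map size_enum_ord.
pose z0 : F * nat * nat := (0, 0%N, 0%N).
have tE (i : 'I_n) : (nth z0 t i).1 = (b i, h i).
  rewrite -(nth_map _ (0, 0%N)) ?size_t // ts (nth_map i) ?size_enum_ord //.
  by rewrite nth_ord_enum.
exists (fun i => (nth z0 t i).2); split.
- move=> i; have := all_nthP z0 th i; rewrite size_t tE; exact.
- have -> : (\sum_i h i)%N = sumn (map snd [seq (b i, h i) | i <- enum 'I_n]).
    by rewrite -map_comp sumnE big_map big_enum.
  rewrite -te; congr (_ + _)%N; rewrite sumnE big_map.
  by rewrite [RHS](big_nth z0) size_t big_mkord.
- suff <- : ffact_det n t = \det (ffact_mx b (fun i => (nth z0 t i).2)) by [].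
  by congr (\det _); apply/matrixP => i j; rewrite !mxE tE.
Qed.

(** Decrease entries that exceed the lower bound one unit at a time. *)
Lemma shrink_to_sum (n l N : nat) (h : 'I_n -> nat) :
  (forall i, l <= h i)%N -> (n * l <= N)%N -> (N <= \sum_i h i)%N ->
  exists2 h' : 'I_n -> nat, forall i, (l <= h' i <= h i)%N & (\sum_i h' i = N)%N.
Proof.
move=> lh lN Nh; have [k] := ubnP (\sum_i h i - N).
elim: k h lh Nh => // k IHk h lh Nh hk.
have [NE|ltN] := eqVneq N (\sum_i h i)%N.
  by exists h => // i; rewrite lh leqnn.
have [i0 li0] : exists i, (l < h i)%N.
  apply/existsP; apply: contraNT ltN; rewrite negb_exists => /forallP hl.
  rewrite eqn_leq Nh /=; apply: leq_trans lN; rewrite -[n in (n * l)%N]card_ord.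
  by rewrite -sum_nat_const; apply: leq_sum => i _; rewrite leqNgt hl.
pose g i := (h i - (i == i0))%N.
have sum_g : (\sum_i g i + 1 = \sum_i h i)%N.
  rewrite (bigD1 i0) //= [in RHS](bigD1 i0) //= /g eqxx.
  rewrite (eq_bigr h) => [|i /negPf->]; last by rewrite subn0.
  by move: (bigop _ _ _) => S; lia.
have [||//|h' h'P h'N] := IHk g.
- by move=> i; rewrite /g; case: eqP => [->|_]; have := lh i; lia.
- by move: ltN; lia.
- by lia.
- by exists h' => // i; have := h'P i; rewrite /g; lia.
Qed.

(** For n <> 2 the hypotheses force h_i <= m.  For n = 2 an exponent may be
m + 1; the other one is then 0, and the nonvanishing determinant is
m + 1 times a coefficient up to sign, so m + 1 is nonzero in F as well. *)
Lemma exponents_exist (F : fieldType) (n m : nat) (b : 'I_n -> F)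
    (h : 'I_n -> nat) :
  (0 < n)%N -> (forall i, b i != 0) -> natr_neq0_upto F m ->
  (n = 2%N -> \sum_i (b i)^-1 = 0 -> natr_neq0_upto F m.+1) ->
  (forall i, 2 * n - 3 <= h i)%N -> (\sum_i h i = m + n * (n - 1))%N ->
  exists e : 'I_n -> nat, [/\ forall i, (e i <= h i)%N,
    forall i, natr_neq0_upto F (e i), (\sum_i e i = m + 'C(n, 2))%N
    & \det (ffact_mx b e) != 0].
Proof.
move=> n0 b0 hm h2 hl hs.
have binE : (n * (n - 1) = 'C(n, 2) * 2)%N.
  by rewrite subn1 (mulnC _ 2) -mul_bin_diag bin1.
have sumE (e : 'I_n -> nat) : (\sum_i e i + 'C(n, 2) = \sum_i h i)%N ->
    (\sum_i e i = m + 'C(n, 2))%N.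
  by rewrite hs binE; lia.
have [n2|n2] := eqVneq n 2%N; last first.
  have hh i : natr_neq0_upto F (h i).
    apply: natr_neq0_uptoW hm; rewrite -(leq_add2r (n * (n - 1))) -hs.
    rewrite (bigD1 i) //= leq_add2l.
    have : (\sum_(j | j != i) (2 * n - 3) <= \sum_(j | j != i) h j)%N.
      exact: leq_sum.
    rewrite sum_nat_const cardC1 card_ord; move: (bigop _ _ _) => S.
    by case: (n) n0 n2 => [|[|[|k]]] //= _ _; nia.
  have [|e [eh es ed]] := @reachable_exponents F n b h.
    apply: reachable_large; rewrite size_map size_enum_ord //.
    by move=> _ /mapP[i _ ->]; split=> /=.
  exists e; split=> // [i|]; first exact: natr_neq0_uptoW (hh i).
  exact: sumE.
subst n; pose i1 : 'I_2 := lift ord0 ord0.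
have sum2 (T : nmodType) (f : 'I_2 -> T) : \sum_i f i = f ord0 + f i1.
  by rewrite !big_ord_recl big_ord0 addr0.
have sumn2 (f : 'I_2 -> nat) : (\sum_i f i = f ord0 + f i1)%N.
  by rewrite !big_ord_recl big_ord0 addn0.
have [|e [eh es ed]] := @reachable_exponents F 2 b h.
  rewrite !enum_ordSl enum_ord0 /=; apply: reachable_seq2 => //=.
  have [bb|] := eqVneq (b ord0 + b i1) 0; [right|by left].
  have -> : (h ord0 + h i1 - 1 = m.+1)%N by rewrite -sumn2 hs; lia.
  apply: h2; rewrite ?leqnn // sum2 -(addr0_eq bb) invrN subrr //.
have e2 := sumE e es; rewrite sumn2 binn in e2.
exists e; split=> //; last exact: sumE.
have [he0 he1] : natr_neq0_upto F (e ord0) /\ natr_neq0_upto F (e i1).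
  move: ed; rewrite det_mx22 !mxE.
  have -> : (1 : 'I_2) = i1 by apply: val_inj.
  rewrite !expr0 !ffactn0 !mul1r !mulr1 -[nat_of_ord i1]/1%N.
  rewrite !expr1 !ffactn1 => ed.
  have succ : m.+1%:R != 0 :> F -> natr_neq0_upto F m.+1.
    move=> m1 k /andP[k0]; rewrite leq_eqVlt ltnS => /orP[/eqP -> //|km].
    by apply: hm; rewrite k0.
  have [e0m|e0m] := leqP (e ord0) m; last first.
    have e0E : e ord0 = m.+1 by lia.
    have e1E : e i1 = 0%N by lia.
    rewrite e1E e0E in ed *; split; last by case.
    apply: succ; apply: contraNneq ed => ->; rewrite !mulr0 subr0 //.
  have [e1m|e1m] := leqP (e i1) m; last first.
    have e1E : e i1 = m.+1 by lia.
    have e0E : e ord0 = 0%N by lia.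
    rewrite e1E e0E in ed *; split; first by case.
    apply: succ; apply: contraNneq ed => ->; rewrite !mulr0 subr0 //.
  by split; exact: natr_neq0_uptoW hm.
move=> i; case: (unliftP ord0 i) => [j|] -> //.
by rewrite (ord1 j).
Qed.

(** * Restricted sumsets *)

(** The exponents of exponents_exist, after the sizes minus one have been shrunk
to the sum m + n (n - 1), are fed to the polynomial method. *)
Lemma distinct_sums_lower (F : fieldType) (n m : nat) (a : 'I_n -> F)
    (A : 'I_n -> {fset F}) :
  (0 < n)%N -> (forall i, a i != 0) -> (forall i, 2 * n - 2 <= #|` A i|)%N ->
  natr_neq0_upto F m -> (n = 2%N -> \sum_i a i = 0 -> natr_neq0_upto F m.+1) ->
  ((n - 1) ^ 2 <= m.+1)%N -> (n ^ 2 + m <= \sum_i #|` A i|)%N ->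
  (m < #|` distinct_sums a A|)%N.
Proof.
move=> n0 a0 hA hm h2 nm mA.
have A_gt0 i : (0 < #|` A i|)%N.
  have [n1|n1] := leqP n 1; last by apply: leq_trans (hA i); lia.
  have n1E : n = 1%N by lia.
  by subst n; move: mA; rewrite big_ord1 (ord1 i); apply: leq_trans.
pose h i := (#|` A i| - 1)%N.
have sum_h : (\sum_i h i + n = \sum_i #|` A i|)%N.
  rewrite -[X in (_ + X)%N]card_ord -sum1_card -big_split /=.
  by apply: eq_bigr => i _; rewrite subnK.
have [|||h' h'h h'N] := @shrink_to_sum n (2 * n - 3) (m + n * (n - 1)) h.
- by move=> i; rewrite /h; have := hA i; lia.
- by move: nm; case: n {n0 hA h2 mA a0 A_gt0 h sum_h a A} => [|[|k]]; nia.
- move: mA; rewrite -sum_h; move: (bigop _ _ _) => T.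
  by case: (n) n0 => // k _; nia.
have [|||e [eh he es ed]] :=
  @exponents_exist F n m (fun i => (a i)^-1) h' n0 _ hm _ _ h'N.
- by move=> i; rewrite invr_eq0.
- by move=> n2; under eq_bigr do rewrite invrK; exact: h2.
- by move=> i; case/andP: (h'h i).
apply: (distinct_sums_gt a0 hm he _ es ed) => i.
have /andP[_ h'i] := h'h i; have := eh i; have := A_gt0 i.
by move: h'i; rewrite /h; lia.
Qed.

Lemma one_order_spec (F : fieldType) :
  (exists2 p : nat, one_order F = p%:Z%:E &
     (1 < p)%N /\ natr_neq0_upto F p.-1) \/
  (one_order F = +oo%E /\ forall q, natr_neq0_upto F q).
Proof.
rewrite /one_order; case: pselect => [exF|nexF]; [left|right].
  case: ex_minnP => p /andP[p0 pF] pmin; exists p => //; split.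
    rewrite ltn_neqAle p0 andbT eq_sym; apply: contraTneq pF => ->.
    exact: oner_neq0.
  move=> k /andP[k0 kp]; apply/negP => kF.
  have /pmin : (0 < k)%N && (k%:R == 0 :> F) by rewrite k0.
  by lia.
split=> // q k /andP[k0 _]; apply/negP => kF; apply: nexF.
by exists k; rewrite k0.
Qed.

Theorem theorem1p2 (n : nat) (n_gt0 : (0 < n)%N) (F : fieldType)
  (pF : ((((n - 1) ^ 2)%N%:Z)%:E <= one_order F)%E)
  (a : 'I_n -> F) (a_neq0 : forall i, a i != 0)
  (A : 'I_n -> {fset F}) (A_ge : forall i, (2 * n - 2 <= #|` A i|)%N) :
  (Order.min (one_order F - ((defect a)%:Z)%:E)
     ((\sum_(i < n) (#|` A i|)%:Z - n%:Z ^+ 2 + 1)%:E)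
   <= ((#|` distinct_sums a A|)%:Z)%:E)%E.
Proof.
rewrite ge_min; set S := (\sum_(i < n) #|` A i|)%N.
have -> : \sum_(i < n) (#|` A i|)%:Z = S%:Z.
  by rewrite /S (big_morph Posz PoszD (erefl (Posz 0))).
have [ltS|leS] := ltnP S (n ^ 2).
  apply/orP; right; rewrite lee_fin; apply: (@le_trans _ _ 0) => //.
  by move: ltS; lia.
have sizeS : ((n - 1) ^ 2 <= (S - n ^ 2).+1)%N.
  have : (n * (2 * n - 2) <= S)%N.
    rewrite -[n in (n * _)%N]card_ord -sum_nat_const; exact: leq_sum.
  by case: (n) n_gt0 leS => // k _; nia.
have [[p pE [p1 hp]]|[pE hp]] := one_order_spec F; last first.
  apply/orP; right; rewrite lee_fin.
  suff : (S - n ^ 2 < #|` distinct_sums a A|)%N by move: leS; lia.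
  by apply: distinct_sums_lower => //; rewrite subnKC.
rewrite pE lee_fin lez_nat in pF; rewrite pE -EFinB !lee_fin.
(* m + 1 is the claimed bound. *)
pose m := minn (S - n ^ 2) (p - defect a - 1).
suff : (m < #|` distinct_sums a A|)%N.
  rewrite /m /minn; case: ifP => _ mC; apply/orP; [right|left]; move: mC leS.
    by lia.
  by rewrite /defect; case: ifP; lia.
have mS : (m <= S - n ^ 2)%N := geq_minl _ _.
have mp : (m <= p - defect a - 1)%N := geq_minr _ _.
apply: distinct_sums_lower => //.
- by apply: natr_neq0_uptoW hp; lia.
- move=> n2 sum0; apply: natr_neq0_uptoW hp.
  by move: mp; rewrite /defect sum0 eqxx andbT (introT eqP n2); lia.
- rewrite /m /minn; case: ifP => // _; move: pF; rewrite /defect.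
  by case: ifP => [/andP[/eqP n2 _]|_]; [rewrite n2|]; lia.
- by rewrite -leq_subRL.
Qed.
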